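(* Let $\mathcal X\subset\mathbb R^d$ be open, let $\mathbb P,\mathbb Q$ be Borel probability measures on $\mathcal X$, where $\mathbb P$ has positive density $p$, and let $m:\mathcal X\to\mathbb R^{d\times d}$ be a diffusion matrix. For any matrix-valued kernel $K:\mathcal X\times\mathcal X\to\mathbb R^{d\times d}$ with RKHS $\mathcal H^d$ of functions $\mathcal X\to\mathbb R^d$, one has $$\mathcal S^m_p[f](x)=\langle \mathcal S^{m,1}_pK_x,f\rangle_{\mathcal H^d}\qquad\text{for any } f\in\mathcal H^d .$$ Moreover, if $x\mapsto\|\mathcal S_p^{m,1}K_x\|_{\mathcal H^d}\in L^1(\mathbb Q)$, then $$\mathrm{DKSD}_{K,m}(\mathbb Q\|\mathbb P)^2:=\sup_{h\in\mathcal H^d,\ \|h\|\le 1}\Big|\int_{\mathcal X}\mathcal S^m_p[h]\,d\mathbb Q\Big|^2=\int_{\mathcal X}\int_{\mathcal X}k^0(x,y)\,d\mathbb Q(x)\,d\mathbb Q(y),$$ where $$k^0(x,y):=\mathcal S_p^{m,2}\mathcal S_p^{m,1}K(x,y)=\frac{1}{p(y)p(x)}\nabla_y\cdot\nabla_x\cdot\big(p(x)\,m(x)K(x,y)m(y)^{\top}p(y)\big).$$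
   Context: For a matrix field $A$, $\nabla\cdot A$ is the vector field with components $(\nabla\cdot A)_i=\sum_j\partial_jA_{ji}$. The diffusion Stein operator with diffusion matrix $m$ acts on vector fields $g:\mathcal X\to\mathbb R^d$ by $\mathcal S_p^m[g]=\frac1p\nabla\cdot(p\,m\,g)$ (a scalar function) and on matrix fields $A:\mathcal X\to\mathbb R^{d\times d}$ by $\mathcal S_p^m[A]=\frac1p\nabla\cdot(p\,m\,A)$ (a vector field). $K$ is the kernel of $\mathcal H^d$ means: for all $x\in\mathcal X$, $v\in\mathbb R^d$, $K(\cdot,x)v\in\mathcal H^d$ and $\langle f(x),v\rangle_{\mathbb R^d}=\langle f,K(\cdot,x)v\rangle_{\mathcal H^d}$ for all $f\in\mathcal H^d$. $K_x=K(x,\cdot)$. $\mathcal S_p^{m,1}$ (resp. $\mathcal S_p^{m,2}$) denotes $\mathcal S_p^m$ applied in the first (resp. second) variable; $\mathcal S^{m,1}_pK_x$ is the function $y\mapsto \frac1{p(x)}\nabla_x\cdot\big(p(x)m(x)K(x,y)\big)\in\mathbb R^d$. In components $k^0(x,y)=\frac1{p(x)p(y)}\sum_{i,l,r,s}\partial_{y^l}\partial_{x^i}\big(p(x)m_{ir}(x)K_{rs}(x,y)m_{ls}(y)p(y)\big)$.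
   Formalization: The density p and the diffusion matrix m are assumed differentiable on X, and the kernel K is assumed of class C^(1,1) (K, its first partials in each variable and its mixed partials exist and are jointly continuous), so that the Stein operator and k^0 are defined. *)

(* Defs.v *)
(* MathComp-Analysis; R^d is 'cV[R]_d over an abstract R : realType. *)
From HB Require Import structures.
From mathcomp Require Import all_boot all_order all_algebra.
From mathcomp Require Import all_classical all_reals all_analysis.

Set Implicit Arguments.
Unset Strict Implicit.
Unset Printing Implicit Defensive.

Import Order.TTheory GRing.Theory Num.Theory.
Import numFieldNormedType.Exports.

Local Open Scope classical_set_scope.
Local Open Scope ring_scope.

(* Functions on an open set X of R^d are represented by total functions on R^d
   of which only the values on X matter: every condition and every conclusion
   is restricted to X, and since X is open the derivatives at points of X do
   not depend on the values outside X. *)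

(* The extension by 0 of the restriction of f to X. *)
Definition restr0 (R : realType) (d : nat) (X : set 'cV[R]_d)
    (f : 'cV[R]_d -> 'cV[R]_d) : 'cV[R]_d -> 'cV[R]_d := patch (fun=> 0) X f.

Definition borel (R : realType) (d : nat) :=
  g_sigma_algebraType (@open 'cV[R]_d).

(* Iterated Lebesgue integral of the indicator of A: on Borel sets this is the
   product measure lambda \x ... \x lambda. It is only used as the base
   set function of an integral on Borel sets. *)
Fixpoint lebesgue_cV (R : realType) (d : nat) : set 'cV[R]_d -> \bar R :=
  match d with
  | 0 => fun A => (\1_A (0 : 'cV[R]_0))%:E
  | d'.+1 => fun A =>
      (\int[@lebesgue_measure R]_t
         lebesgue_cV [set v : 'cV[R]_d' | A (col_mx (t%:M : 'cV[R]_1) v)])%E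
  end.

Definition has_positive_density (R : realType) (d : nat) (X : set 'cV[R]_d)
    (P : probability (borel R d) R) (p : 'cV[R]_d -> R) : Prop :=
  (forall x, X x -> 0 < p x) /\
  (forall A : set (borel R d), measurable A -> A `<=` X ->
     P A = \int[(@lebesgue_cV R d : set (borel R d) -> \bar R)]_(x in A)
             (p x)%:E)%E.

Section differential_operators.
Context {R : realType} {d : nat}.
Implicit Types (f g : 'cV[R]_d -> 'cV[R]_d) (A m : 'cV[R]_d -> 'M[R]_d).
Implicit Types (p : 'cV[R]_d -> R) (K : 'cV[R]_d -> 'cV[R]_d -> 'M[R]_d).

Definition basis_cV (i : 'I_d) : 'cV[R]_d := delta_mx i 0.

Definition div_vec g (x : 'cV[R]_d) : R :=
  \sum_i 'D_(basis_cV i) (fun z => g z i 0) x.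

(* 'D is a junk value where the partial derivative does not exist. *)
Definition has_div g (x : 'cV[R]_d) : Prop :=
  forall i, derivable (fun z => g z i 0) x (basis_cV i).

Definition div_mx A (x : 'cV[R]_d) : 'cV[R]_d :=
  \col_i \sum_j 'D_(basis_cV j) (fun z => A z j i) x.

Definition stein_vec p m g (x : 'cV[R]_d) : R :=
  (p x)^-1 * div_vec (fun z => p z *: (m z *m g z)) x.

Definition stein_mx p m A (x : 'cV[R]_d) : 'cV[R]_d :=
  (p x)^-1 *: div_mx (fun z => p z *: (m z *m A z)) x.

(* S^{m,1} K_x, a function of the second argument of K. *)
Definition stein1 p m K (x y : 'cV[R]_d) : 'cV[R]_d :=
  stein_mx p m (K^~ y) x.

(* k^0 = S^{m,2} S^{m,1} K. *)
Definition stein_kernel p m K (x y : 'cV[R]_d) : R :=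
  stein_vec p m (stein1 p m K x) y.

(* K is of class C^(1,1) on X x X: K is differentiable once in each of its two
   arguments, and K, its first-order partial derivatives and its mixed
   derivatives are jointly continuous. *)
Definition kernel_C11 (X : set 'cV[R]_d) K : Prop :=
  [/\ {in X `*` X, continuous (fun z : 'cV[R]_d * 'cV[R]_d => K z.1 z.2)},
      forall i, let dK x y := 'D_(basis_cV i) (K^~ y) x in
        (forall x y, X x -> X y -> derivable (K^~ y) x (basis_cV i)) /\
        {in X `*` X, continuous (fun z => dK z.1 z.2)},
      forall j, let dK x y := 'D_(basis_cV j) (K x) y in
        (forall x y, X x -> X y -> derivable (K x) y (basis_cV j)) /\
        {in X `*` X, continuous (fun z => dK z.1 z.2)} &
      forall i j, let dK x y := 'D_(basis_cV i) (K^~ y) x in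
        (forall x y, X x -> X y -> derivable (dK x) y (basis_cV j)) /\
        {in X `*` X, continuous (fun z => 'D_(basis_cV j) (dK z.1) z.2)}].

End differential_operators.

(* A Hilbert space of functions X -> R^d. A function on X is identified with
   its extension by 0, so that equality of elements is equality on X. The
   values of hdot outside the carrier are irrelevant. *)
Record hilbert_fun (R : realType) (d : nat) (X : set 'cV[R]_d) := HilbertFun {
  hset : set ('cV[R]_d -> 'cV[R]_d) ;
  hdot : ('cV[R]_d -> 'cV[R]_d) -> ('cV[R]_d -> 'cV[R]_d) -> R ;
  hset_supp : forall f, hset f -> forall x, ~ X x -> f x = 0 ;
  hset0 : hset (fun=> 0) ;
  hset_lin : forall (a : R) f g, hset f -> hset g ->
    hset (fun x => a *: f x + g x) ;
  hdotC : forall f g, hset f -> hset g -> hdot f g = hdot g f ;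
  hdot_lin : forall (a : R) f g h, hset f -> hset g -> hset h ->
    hdot (fun x => a *: f x + g x) h = a * hdot f h + hdot g h ;
  hdot_ge0 : forall f, hset f -> 0 <= hdot f f ;
  hdot_eq0 : forall f, hset f -> hdot f f = 0 -> forall x, f x = 0 ;
  hset_complete : forall u : nat -> ('cV[R]_d -> 'cV[R]_d),
    let dist f g := Num.sqrt (hdot (fun x => f x - g x) (fun x => f x - g x)) in
    (forall n, hset (u n)) ->
    (forall e : R, 0 < e -> exists N, forall k n, (N <= k)%N -> (N <= n)%N ->
       dist (u k) (u n) < e) ->
    exists2 f, hset f & (fun n => dist (u n) f) @ \oo --> (0 : R)
}.

Section rkhs.
Context {R : realType} {d : nat} {X : set 'cV[R]_d}.
Implicit Types (H : hilbert_fun X) (K : 'cV[R]_d -> 'cV[R]_d -> 'M[R]_d).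

Definition hnorm H f : R := Num.sqrt (hdot H f f).

(* The functions K(., x) v are in H and <f(x), v> = <f, K(., x) v>_H; the
   inner product of R^d is written u^T v. *)
Definition is_kernel_of K H : Prop :=
  forall (x v : 'cV[R]_d), X x ->
    let Kxv := restr0 X (fun y => K y x *m v) in
    hset H Kxv /\ forall f, hset H f -> ((f x)^T *m v) 0 0 = hdot H f Kxv.

(* DKSD_{K,m}(Q || P)^2, valued in the extended reals. *)
Definition DKSD_sq H (p : 'cV[R]_d -> R) (m : 'cV[R]_d -> 'M[R]_d)
    (Q : probability (borel R d) R) : \bar R :=
  ereal_sup [set (`| \int[Q]_(x in X) (stein_vec p m h x)%:E | ^+ 2)%E
            | h in [set h | hset H h /\ hnorm H h <= 1]].

End rkhs.

(* Main.v *)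
Require Import Defs.
From HB Require Import structures.
From mathcomp Require Import all_boot all_order all_algebra.
From mathcomp Require Import all_classical all_reals all_analysis.
From mathcomp Require Import measurable_realfun ring lra.

Set Implicit Arguments.
Unset Strict Implicit.
Unset Printing Implicit Defensive.

Import Order.TTheory GRing.Theory Num.Theory.
Import numFieldNormedType.Exports.

Local Open Scope classical_set_scope.
Local Open Scope ring_scope.

(* The functions K(., x) e_r =: feature x r satisfy <f, feature x r> = f_r(x)
   and <feature x r, feature y r> = K_rr(y, x). Hence the Gram matrix of the
   difference quotients of x |-> feature x r in a direction e consists of mixed
   second difference quotients of K_rr, which by the mean value theorem tend to
   the continuous mixed derivative of K_rr. The difference quotients are thus
   Cauchy in H, and their limit represents f |-> (d_e f_r)(x). Combining these
   limits with the features, the product rule yields a representer of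
   f |-> S_p^m[f](x), and testing it against the features identifies it with
   S^{m,1} K_x. If |S^{m,1} K_x| is Q-integrable, f |-> int S_p^m[f] dQ is a
   bounded functional on H, represented by some M, and both the squared
   discrepancy and the double integral of k^0 are equal to |M|^2. *)

(** * Hilbert space geometry: Cauchy-Schwarz, weak limits along filters, Riesz representation *)

Section hilbert_space.
Context {R : realType} {d : nat} {X : set 'cV[R]_d} (H : hilbert_fun X).
Implicit Types (a : R) (f g h : 'cV[R]_d -> 'cV[R]_d).

Local Notation "''<<' f , g '>>'" := (hdot H f g).

Lemma hsetZD a f g : hset H f -> hset H g -> hset H (a *: f + g).
Proof. exact: hset_lin. Qed.

Lemma hset_0 : hset H 0.
Proof. exact: hset0. Qed.

Lemma hsetD f g : hset H f -> hset H g -> hset H (f + g).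
Proof. by move=> Hf Hg; rewrite -[f]scale1r; exact: hsetZD. Qed.

Lemma hsetZ a f : hset H f -> hset H (a *: f).
Proof. by move=> Hf; rewrite -[_ *: _]addr0; apply: hsetZD => //; exact: hset_0. Qed.

Lemma hsetB f g : hset H f -> hset H g -> hset H (f - g).
Proof. by move=> Hf Hg; rewrite addrC -scaleN1r; exact: hsetZD. Qed.

Lemma hset_sum n (F : 'I_n -> 'cV[R]_d -> 'cV[R]_d) :
  (forall i, hset H (F i)) -> hset H (\sum_i F i).
Proof. by move=> HF; elim/big_ind : _ => //; [exact: hset_0|exact: hsetD]. Qed.

Lemma hdotZDl a f g h : hset H f -> hset H g -> hset H h ->
  '<<a *: f + g, h>> = a * '<<f, h>> + '<<g, h>>.
Proof. exact: hdot_lin. Qed.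

Lemma hdotDl f g h : hset H f -> hset H g -> hset H h ->
  '<<f + g, h>> = '<<f, h>> + '<<g, h>>.
Proof. by move=> Hf Hg Hh; rewrite -{1}[f]scale1r hdotZDl// mul1r. Qed.

Lemma hdot0l h : hset H h -> '<<0, h>> = 0.
Proof.
move=> Hh; have := hdotDl hset_0 hset_0 Hh.
by rewrite addr0 -[LHS]addr0 => /addrI.
Qed.

Lemma hdotZl a f h : hset H f -> hset H h -> '<<a *: f, h>> = a * '<<f, h>>.
Proof.
by move=> Hf Hh; rewrite -[_ *: _]addr0 hdotZDl ?hdot0l ?addr0//; exact: hset_0.
Qed.

Lemma hdotBl f g h : hset H f -> hset H g -> hset H h ->
  '<<f - g, h>> = '<<f, h>> - '<<g, h>>.
Proof.
by move=> Hf Hg Hh; rewrite addrC -scaleN1r hdotZDl// mulN1r addrC.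
Qed.

Lemma hdotDr f g h : hset H f -> hset H g -> hset H h ->
  '<<h, f + g>> = '<<h, f>> + '<<h, g>>.
Proof.
by move=> Hf Hg Hh; rewrite hdotC ?hdotDl// ?(hdotC Hh)//; exact: hsetD.
Qed.

Lemma hdotZr a f h : hset H f -> hset H h -> '<<h, a *: f>> = a * '<<h, f>>.
Proof. by move=> Hf Hh; rewrite hdotC ?hdotZl// ?(hdotC Hh)//; exact: hsetZ. Qed.

Lemma hdotBr f g h : hset H f -> hset H g -> hset H h ->
  '<<h, f - g>> = '<<h, f>> - '<<h, g>>.
Proof.
by move=> Hf Hg Hh; rewrite hdotC ?hdotBl// ?(hdotC Hh)//; exact: hsetB.
Qed.

Lemma hdot_suml n (F : 'I_n -> 'cV[R]_d -> 'cV[R]_d) h :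
  (forall i, hset H (F i)) -> hset H h ->
  '<<\sum_i F i, h>> = \sum_i '<<F i, h>>.
Proof.
move=> HF Hh; pose K f c := hset H f /\ '<<f, h>> = c.
suff [] : K (\sum_i F i) (\sum_i '<<F i, h>>) by [].
elim/big_ind2 : _ => [|f c g e [Hf <-] [Hg <-]|i _]; split=> //.
- exact: hset_0.
- exact: hdot0l.
- exact: hsetD.
- exact: hdotDl.
Qed.

(** Expand the squared norm of [<g, g> f - <f, g> g], which equals [<g, g>] times the difference of
    the two sides. *)
Lemma cauchy_schwarz_sq f g : hset H f -> hset H g ->
  '<<f, g>> ^+ 2 <= '<<f, f>> * '<<g, g>>.
Proof.
move=> Hf Hg; have [gg0|gg0] := eqVneq '<<g, g>> 0.
  have -> : g = 0 by apply/funext => x; exact: hdot_eq0 gg0 x.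
  by rewrite hdotC ?hdot0l ?expr0n ?mulr0//; exact: hset_0.
have gg_gt0 : 0 < '<<g, g>> by rewrite lt0r gg0 hdot_ge0.
have Ha := hsetZ '<<g, g>> Hf; have Hb := hsetZ '<<f, g>> Hg.
have := hdot_ge0 (hsetB Ha Hb).
rewrite hdotBl ?hdotBr ?hdotZl ?hdotZr//; last exact: hsetB.
rewrite (hdotC Hg Hf) => ge0.
rewrite -(ler_pM2l gg_gt0) -subr_ge0; apply: le_trans ge0 _.
by rewrite le_eqVlt; apply/orP; left; apply/eqP; ring.
Qed.

Lemma sqr_hnorm f : hset H f -> hnorm H f ^+ 2 = '<<f, f>>.
Proof. by move=> Hf; rewrite sqr_sqrtr// hdot_ge0. Qed.

Lemma cauchy_schwarz f g : hset H f -> hset H g ->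
  `|'<<f, g>>| <= hnorm H f * hnorm H g.
Proof.
move=> Hf Hg; rewrite -(@ler_pXn2r _ 2)// ?nnegrE ?mulr_ge0 ?sqrtr_ge0//.
by rewrite real_normK ?num_real// exprMn !sqr_hnorm// cauchy_schwarz_sq.
Qed.

Lemma hdot_parallelogram f g : hset H f -> hset H g ->
  '<<f + g, f + g>> + '<<f - g, f - g>> = 2 * '<<f, f>> + 2 * '<<g, g>>.
Proof.
move=> Hf Hg; have HD := hsetD Hf Hg; have HB := hsetB Hf Hg.
rewrite hdotBl// !hdotBr// hdotDl// !hdotDr// (hdotC Hg Hf); ring.
Qed.

Lemma hcomplete (u : nat -> 'cV[R]_d -> 'cV[R]_d) : (forall n, hset H (u n)) ->
  (forall e : R, 0 < e -> exists N, forall k n, (N <= k)%N -> (N <= n)%N ->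
     '<<u k - u n, u k - u n>> < e) ->
  exists2 f, hset H f & '<<u n - f, u n - f>> @[n --> \oo] --> (0 : R).
Proof.
move=> Hu cu; have [|f Hf uf] := @hset_complete _ _ _ H u Hu.
  move=> e e0; have [N uN] := cu (e ^+ 2) (exprn_gt0 _ e0).
  exists N => k n Nk Nn.
  rewrite -(@ltr_pXn2r _ 2)// ?nnegrE ?sqrtr_ge0 ?(ltW e0)//.
  by rewrite sqr_sqrtr ?uN//; exact/hdot_ge0/hsetB.
exists f => //; rewrite -[X in _ --> X](mulr0 0).
apply: cvg_trans (cvgM uf uf); apply: near_eq_cvg.
apply: nearW => n; rewrite /= -expr2 sqr_sqrtr//.
exact/hdot_ge0/hsetB.
Qed.

(** Completeness is given for sequences only. A sequence of indices is drawn from filter sets of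
    shrinking diameter; its limit [g] is then shown to attract the whole filter, and Cauchy-Schwarz
    turns norm convergence into weak convergence. *)
Lemma hcauchy_weak_cvg {I : Type} (F : set_system I) {FF : ProperFilter F}
    (u : I -> 'cV[R]_d -> 'cV[R]_d) :
  (\forall i \near F, hset H (u i)) ->
  (forall e : R, 0 < e -> exists2 A, F A &
     forall i j, A i -> A j -> '<<u i - u j, u i - u j>> < e) ->
  exists2 g, hset H g &
    forall f, hset H f -> '<<u i, f>> @[i --> F] --> '<<g, f>>.
Proof.
move=> Hu cu.
have {}cu (n : nat) : {A : set I | F A /\ (forall i, A i -> hset H (u i)) /\
    forall i j, A i -> A j -> '<<u i - u j, u i - u j>> < n.+1%:R^-1}.
  apply: cid; have [|A FA uA] := cu n.+1%:R^-1; first by rewrite invr_gt0.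
  exists (A `&` (fun i => hset H (u i))); split; first exact: filterI.
  by split=> [i []//|i j [Ai _] [Aj _]]; exact: uA.
pose A n := sval (cu n).
have FA n : F (A n) by case: (svalP (cu n)).
have HA n i : A n i -> hset H (u i) by case: (svalP (cu n)) => _ [+ _]; exact.
have uA n i j : A n i -> A n j -> '<<u i - u j, u i - u j>> < n.+1%:R^-1.
  by case: (svalP (cu n)) => _ [_]; exact.
have /choice[t At] n : exists i, A n i by exact: filter_ex (FA n).
have Hut n : hset H (u (t n)) by exact: HA (At n).
(* This replaces the triangle inequality, since all distances are kept squared. *)
have parle f g : hset H f -> hset H g ->
    '<<f + g, f + g>> <= 2 * '<<f, f>> + 2 * '<<g, g>>.
  move=> Hf Hg; rewrite -hdot_parallelogram// lerDl.
  exact/hdot_ge0/hsetB.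
have distt n i : A n i -> forall k, '<<u i - u (t k), u i - u (t k)>> <=
    2 * n.+1%:R^-1 + 2 * k.+1%:R^-1.
  (* Two sets of a proper filter meet, so the estimate passes through an index [s] common to [A n]
     and [A k]. *)
  move=> Ai k; have [s [Ans Aks]] := filter_ex (filterI (FA n) (FA k)).
  have [Hi Hs] := (HA _ _ Ai, HA _ _ Ans).
  rewrite (_ : u i - u (t k) = (u i - u s) + (u s - u (t k))); last first.
    by rewrite addrA subrK.
  apply: le_trans (parle _ _ (hsetB Hi Hs) (hsetB Hs (Hut k))) _.
  by rewrite lerD// ler_pM2l// ltW// uA.
have small (e : R) : 0 < e -> exists N, forall n, (N <= n)%N -> n.+1%:R^-1 < e.
  move=> e0; have [N _ NP] : \forall n \near \oo, n.+1%:R^-1 < e.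
    exact: near_infty_natSinv_lt (PosNum e0).
  by exists N => n Nn; exact: NP.
have [|g Hg ug] := @hcomplete (u \o t) Hut.
  move=> e e0; have [|N NP] := small (e / 4); first by rewrite divr_gt0.
  exists N => k n Nk Nn; apply: le_lt_trans (distt _ _ (At k) n) _.
  move: (NP _ Nk) (NP _ Nn); move: k.+1%:R^-1 n.+1%:R^-1 => a b; lra.
exists g => // f Hf; apply/cvgrPdist_lt => e e0.
(* The [+ 1] keeps [c] positive when [f] is 0, and [e1] is chosen so that [8 * e1 * c = e ^+ 2]. *)
pose c := hnorm H f ^+ 2 + 1.
have c0 : 0 < c by rewrite ltr_wpDl// sqr_ge0.
pose e1 := e ^+ 2 / (8 * c).
have e10 : 0 < e1 by rewrite divr_gt0 ?exprn_gt0// mulr_gt0.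
have [N NP] := small _ e10.
have [M MP] : exists M, forall n, (M <= n)%N ->
    '<<u (t n) - g, u (t n) - g>> < e1.
  move/cvgrPdist_lt : ug => /(_ _ e10)[M _ MP]; exists M => n /MP /=.
  by rewrite distrC subr0 => /(le_lt_trans (ler_norm _)).
pose n := maxn N M.
apply: filterS (FA n) => i Ai.
have Hi := HA _ _ Ai.
have le1 : '<<u i - g, u i - g>> < 8 * e1.
  rewrite (_ : u i - g = (u i - u (t n)) + (u (t n) - g)); last first.
    by rewrite addrA subrK.
  apply: le_lt_trans (parle _ _ (hsetB Hi (Hut n)) (hsetB (Hut n) Hg)) _.
  have := uA _ _ _ Ai (At n); have := MP _ (leq_maxr N M).
  have := NP _ (leq_maxl N M); rewrite -/n.
  set x := '<<_, _>>; set y := '<<_, _>>; set z := n.+1%:R^-1; lra.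
rewrite distrC -hdotBl// -(@ltr_pXn2r _ 2)// ?nnegrE ?normr_ge0 ?(ltW e0)//.
rewrite real_normK ?num_real//.
apply: le_lt_trans (cauchy_schwarz_sq (hsetB Hi Hg) Hf) _.
have -> : e ^+ 2 = 8 * e1 * c by rewrite /e1; field; rewrite gt_eqF.
apply: (@le_lt_trans _ _ ('<<u i - g, u i - g>> * c)).
  by rewrite ler_wpM2l ?hdot_ge0//; [exact: hsetB|rewrite /c sqr_hnorm// lerDl].
by rewrite ltr_pM2r.
Qed.

(** In the expansion of the squared norm of [u i - u j], all four inner products tend to the same
    [c] and cancel, so the family is Cauchy. *)
Lemma hdot_cvg_weak_cvg {I : Type} (F : set_system I) {FF : ProperFilter F}
    (u : I -> 'cV[R]_d -> 'cV[R]_d) (c : R) :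
  (\forall i \near F, hset H (u i)) ->
  '<<u i.1, u i.2>> @[i --> filter_prod F F] --> c ->
  exists2 g, hset H g &
    forall f, hset H f -> '<<u i, f>> @[i --> F] --> '<<g, f>>.
Proof.
move=> Hu uc; apply: hcauchy_weak_cvg => // e e0.
have e40 : 0 < e / 4 by rewrite divr_gt0.
move/cvgrPdist_lt : uc => /(_ _ e40)[[A B] /= [FA FB] AB].
exists (A `&` B `&` (fun i => hset H (u i))).
  by apply: filterI => //; exact: filterI.
move=> i j [[Ai Bi] Hi] [[Aj Bj] Hj].
have HB := hsetB Hi Hj.
rewrite hdotBl// !hdotBr//.
move: (AB (i, i) (conj Ai Bi)) (AB (i, j) (conj Ai Bj)).
move: (AB (j, i) (conj Aj Bi)) (AB (j, j) (conj Aj Bj)) => /=.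
by rewrite !ltr_norml; lra.
Qed.

(** Variational proof: the representer minimises [J f], the squared norm of [f] minus [2 * L f]. A
    minimising sequence is Cauchy by the parallelogram law, and the first variation at its limit
    vanishes. *)
Lemma riesz (L : ('cV[R]_d -> 'cV[R]_d) -> R) (C : R) :
  (forall a f g, hset H f -> hset H g -> L (a *: f + g) = a * L f + L g) ->
  (forall f, hset H f -> `|L f| <= C * hnorm H f) ->
  exists2 g, hset H g & forall f, hset H f -> L f = '<<g, f>>.
Proof.
move=> Llin LC; pose J f := '<<f, f>> - 2 * L f.
pose E := [set J f | f in hset H].
have lbE : has_lbound E.
  (* With [N] the norm of [f], [J f] is at least [N ^+ 2 - 2 * C * N], hence at least [- C ^+ 2] by
     completing the square. *)
  exists (- C ^+ 2) => _ [f Hf <-]; rewrite /J -sqr_hnorm//.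
  have := le_trans (ler_norm _) (LC _ Hf).
  have := sqr_ge0 (hnorm H f - C).
  by rewrite sqrrB; nra.
have infE : has_inf E by split=> //; exists (J 0), 0 => //; exact: hset_0.
have infJ f : hset H f -> inf E <= J f by move=> Hf; apply: ge_inf => //; exists f.
have /choice[u uP] (n : nat) :
    exists f, hset H f /\ J f < inf E + n.+1%:R^-1.
  have [|_ [f Hf <-] Jf] := inf_adherent (_ : 0 < n.+1%:R^-1) infE.
    by rewrite invr_gt0.
  by exists f.
have Hu n : hset H (u n) by case: (uP n).
have Ju n : J (u n) < inf E + n.+1%:R^-1 by case: (uP n).
have LZ a f : hset H f -> L (a *: f) = a * L f.
  move=> Hf; have := Llin 1 _ _ hset_0 hset_0; rewrite scaler0 addr0 mul1r => L0.
  have {}L0 : L 0 = 0 by lra.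
  by rewrite -[a *: f]addr0 Llin ?L0 ?addr0//; exact: hset_0.
have near_small (e : R) : 0 < e -> \forall n \near \oo, n.+1%:R^-1 < e.
  by move=> e0; exact: near_infty_natSinv_lt (PosNum e0).
have [|e e0|g Hg ug] := @hcauchy_weak_cvg _ \oo _ u.
- exact: nearW.
- exists (fun n => n.+1%:R^-1 < e / 4); first exact/near_small/divr_gt0.
  move=> i j ie je.
  have HD := hsetD (Hu i) (Hu j).
  (* Comparing [J] at the midpoint with the infimum bounds the squared distance of [u i] and [u j]
     by [2 * (ei + ej)]. *)
  have := infJ _ (hsetZ 2^-1 HD).
  rewrite /J hdotZl//; last exact: hsetZ.
  rewrite hdotZr// LZ// -{3}[u i]scale1r Llin// mul1r.
  have := hdot_parallelogram (Hu i) (Hu j).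
  move: (Ju i) (Ju j); rewrite /J.
  set a := '<<_ + _, _>>; set b := '<<_ - _, _>>.
  move: ie je => /=; move: i.+1%:R^-1 j.+1%:R^-1 => ei ej.
  lra.
exists g => // f Hf; apply/esym/eqP; rewrite -subr_eq0; apply/eqP.
set b := '<<g, f>> - L f.
have J_ge0 t : 0 <= 2 * t * b + t ^+ 2 * '<<f, f>>.
  (* [v n] is [J (t *: f + u n) - J (u n)] plus the error [n.+1%:R^-1], hence nonnegative; its limit
     gives the claim. *)
  pose v n := 2 * t * ('<<u n, f>> - L f) + t ^+ 2 * '<<f, f>> + n.+1%:R^-1.
  have vb : v n @[n --> \oo] --> 2 * t * b + t ^+ 2 * '<<f, f>> + 0.
    apply: cvgD; last exact: cvg_harmonic.
    apply: cvgD; last exact: cvg_cst.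
    apply: cvgM; first exact: cvg_cst.
    by apply: cvgB; [exact: ug|exact: cvg_cst].
  rewrite -[leRHS]addr0 -(cvg_lim _ vb)//; apply: limr_ge.
    by apply/cvg_ex; eexists; exact: vb.
  apply: nearW => n; rewrite /v.
  have := infJ _ (hsetZD t Hf (Hu n)); have := Ju n; rewrite /J.
  rewrite hdotDl ?hdotZl// ?hdotDr ?hdotZr ?Llin//; try exact: hsetZ.
  - by rewrite (hdotC Hf (Hu n)); move: n.+1%:R^-1 => en; lra.
  - by apply: hsetZD.
  - by apply: hsetZD.
set q := '<<f, f>> in J_ge0.
have q0 : 0 <= q by exact: hdot_ge0.
have q1 : 0 < q + 1 by rewrite ltr_wpDl.
(* Nearly the minimiser [- b / q] of the quadratic; [q + 1] also covers [q = 0]. *)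
have := J_ge0 (- b / (q + 1)).
have -> : 2 * (- b / (q + 1)) * b + (- b / (q + 1)) ^+ 2 * q =
    - (b ^+ 2 * (q + 2) / (q + 1) ^+ 2) by field; rewrite gt_eqF.
rewrite oppr_ge0 pmulr_lle0 ?invr_gt0 ?exprn_gt0// pmulr_lle0; last first.
  by rewrite ltr_wpDl.
by move=> b2; apply/eqP; rewrite -sqrf_eq0 eq_le b2 sqr_ge0.
Qed.

End hilbert_space.

(** * Mean value theorem along lines and mixed second difference quotients *)

Section difference_quotients.
Context {R : realType}.

Lemma is_derive_line {V W : normedModType R} (f : V -> W) (x v : V) (s : R) :
  derivable f (s *: v + x) v ->
  is_derive s 1 (fun t : R => f (t *: v + x)) ('D_v f (s *: v + x)).
Proof.
have E : (fun h : R => h^-1 *: (((fun t => f (t *: v + x)) \o shift s) (h *: 1)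
      - f (s *: v + x))) =
    (fun h => h^-1 *: ((f \o shift (s *: v + x)) (h *: v) - f (s *: v + x))).
  by apply/funext => h /=; rewrite [h *: 1]mulr1 scalerDl addrA.
by move=> df; split; rewrite /derivable /derive E.
Qed.

(** Bounding the intermediate parameter by [|h|] lets one statement serve both signs of [h], as
    punctured neighbourhoods of 0 require. *)
Lemma MVT_line {V : normedModType R} (f : V -> R) (x v : V) (h : R) :
  (forall s : R, `|s| <= `|h| -> derivable f (s *: v + x) v) ->
  exists2 s : R, `|s| <= `|h| &
    f (h *: v + x) - f x = h * 'D_v f (s *: v + x).
Proof.
move=> df; pose F (t : R) := f (t *: v + x).
have dF (s : R) : `|s| <= `|h| -> is_derive s 1 F ('D_v f (s *: v + x)).
  by move=> /df; exact: is_derive_line.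
have cF (s : R) : `|s| <= `|h| -> {for s, continuous F}.
  move=> /dF [+ _]; move/derivable1_diffP.
  exact: differentiable_continuous.
have F0 : F 0 = f x by rewrite /F scale0r add0r.
have [h0|h0] := leP 0 h.
- have [s| |c] := @MVT_segment R F (fun s => 'D_v f (s *: v + x)) 0 h h0.
  + rewrite in_itv/= => /andP[s0 sh]; apply: dF.
    by rewrite !ger0_norm ?(ltW s0)// ltW.
  + apply: continuous_in_subspaceT => s; rewrite inE/= in_itv/= => /andP[s0 sh].
    by apply: cF; rewrite !ger0_norm.
  + rewrite in_itv/= => /andP[c0 ch] E; exists c; first by rewrite !ger0_norm.
    by rewrite -F0 E subr0 mulrC.
- have [s| |c] := @MVT_segment R F (fun s => 'D_v f (s *: v + x)) h 0 (ltW h0).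
  + rewrite in_itv/= => /andP[hs s0]; apply: dF.
    by rewrite !ler0_norm ?(ltW h0) ?(ltW s0)// lerN2 ltW.
  + apply: continuous_in_subspaceT => s; rewrite inE/= in_itv/= => /andP[hs s0].
    by apply: cF; rewrite !ler0_norm ?(ltW h0)// lerN2.
  + rewrite in_itv/= => /andP[hc c0] E; exists c.
      by rewrite !ler0_norm ?(ltW h0)// lerN2.
    by rewrite -F0 -[LHS]opprB E sub0r mulrN opprK mulrC.
Qed.

Lemma near_line {V : normedModType R} (A : set V) (x v : V) : nbhs x A ->
  exists2 e : R, 0 < e & forall s : R, `|s| < e -> A (s *: v + x).
Proof.
move=> xA; have : nbhs (0 : R) ((fun s : R => s *: v + x) @^-1` A).
  suff : (s *: v + x) @[s --> (0 : R)] --> x by exact.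
  rewrite -{2}[x]add0r -(scale0r v); apply: cvgD; last exact: cvg_cst.
  exact: scalel_continuous.
move=> /nbhs_ballP[e e0 eA]; exists e => // s se.
by apply: (eA s); rewrite /ball/= sub0r normrN.
Qed.

(** Two applications of the mean value theorem, first in [x] and then in [y], turn the quotient into
    the mixed derivative at a nearby point; continuity of that derivative concludes. *)
Lemma mixed_difference_quotient {V W : normedModType R} (k : V -> W -> R)
    (x v : V) (y w : W) (dk := fun a b => 'D_v (k^~ b) a) :
  (\forall z \near (x, y), derivable (k^~ z.2) z.1 v) ->
  (\forall z \near (x, y), derivable (dk z.1) z.2 w) ->
  {for (x, y), continuous (fun z => 'D_w (dk z.1) z.2)} ->
  (fun h : R * R => (h.1 * h.2)^-1 *
     (k (h.1 *: v + x) (h.2 *: w + y) - k x (h.2 *: w + y)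
      - k (h.1 *: v + x) y + k x y))
    @ filter_prod 0^' 0^' --> 'D_w (dk x) y.
Proof.
move=> d1 d2 c12; apply/cvgrPdist_lt => e e0.
move/cvgrPdist_lt : c12 => /(_ _ e0) c12.
have [[A B] /= [xA yB] AB] := filterI d1 (filterI d2 c12).
have [ea ea0 eaA] := near_line v xA; have [eb eb0 ebB] := near_line w yB.
have nz (c : R) : 0 < c -> \forall h \near (0 : R)^', h != 0 /\ `|h| < c.
  move=> c0; near=> h; split; first by near: h; exact: nbhs_dnbhs_neq.
  by near: h; exact: dnbhs0_lt.
exists ((fun h : R => h != 0 /\ `|h| < ea), (fun h : R => h != 0 /\ `|h| < eb)).
  by split; exact: nz.
move=> [h l] [/= [h0 hea] [l0 leb]].
have Bl : B (l *: w + y) by exact: ebB.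
have By : B y by exact: nbhs_singleton.
pose f a := k a (l *: w + y) - k a y.
have [|s sh fE] := @MVT_line _ f x v h.
  move=> s sh; have As : A (s *: v + x) by exact/eaA/(le_lt_trans sh).
  apply: derivableB.
  - by have [] := AB (s *: v + x, l *: w + y) (conj As Bl).
  - by have [] := AB (s *: v + x, y) (conj As By).
have As : A (s *: v + x) by exact/eaA/(le_lt_trans sh).
have dfE : 'D_v f (s *: v + x) = dk (s *: v + x) (l *: w + y) - dk (s *: v + x) y.
  rewrite [LHS]deriveB//.
  - by have [] := AB (s *: v + x, l *: w + y) (conj As Bl).
  - by have [] := AB (s *: v + x, y) (conj As By).
have [|t tl dkE] := @MVT_line _ (dk (s *: v + x)) y w l.
  move=> t tl; have Bt : B (t *: w + y) by exact/ebB/(le_lt_trans tl).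
  by have [_ []] := AB (s *: v + x, t *: w + y) (conj As Bt).
have Bt : B (t *: w + y) by exact/ebB/(le_lt_trans tl).
have [_ [_ /=]] := AB (s *: v + x, t *: w + y) (conj As Bt).
suff -> : k (h *: v + x) (l *: w + y) - k x (l *: w + y) - k (h *: v + x) y
    + k x y = h * l * 'D_w (dk (s *: v + x)) (t *: w + y).
  by rewrite mulKf// mulf_neq0.
rewrite -mulrA -dkE -dfE -fE /f; ring.
Unshelve. all: by end_near. Qed.

End difference_quotients.

Lemma near_open_pair {T U : topologicalType} (A : set T) (B : set U) x y :
  open A -> open B -> A x -> B y -> \forall z \near (x, y), A z.1 /\ B z.2.
Proof.
move=> oA oB Ax By; exists (A, B) => //=.
by split; exact: open_nbhs_nbhs.
Qed.

Lemma derive_coord {R : realType} {V : normedModType R} {m n : nat}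
    (M : V -> 'M[R]_(m, n)) (x v : V) i j : derivable M x v ->
  is_derive x v (fun z => M z i j) ('D_v M x i j).
Proof.
move=> dM; split; first by move/derivable_mxP : dM; exact.
by rewrite derive_mx// mxE.
Qed.

(** * Continuity and partial derivatives of the elements of the RKHS *)

Section features.
Context {R : realType} {d : nat} (X : set 'cV[R]_d) (oX : open X).
Context (H : hilbert_fun X) (K : 'cV[R]_d -> 'cV[R]_d -> 'M[R]_d).
Context (K11 : kernel_C11 X K) (KH : is_kernel_of K H).
Implicit Types (f g : 'cV[R]_d -> 'cV[R]_d) (x y : 'cV[R]_d).

Definition feature x r := restr0 X (fun y => K y x *m basis_cV r).

Lemma featureE x r y : X y -> feature x r y = col r (K y x).
Proof. by move=> Xy; rewrite /feature /restr0 patchT ?inE// colE. Qed.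

Lemma hset_feature x r : X x -> hset H (feature x r).
Proof. by move=> Xx; have [] := KH (basis_cV r) Xx. Qed.

Lemma hdot_feature f x r : hset H f -> X x -> hdot H f (feature x r) = f x r 0.
Proof.
move=> Hf Xx; have [_ /(_ _ Hf) <-] := KH (basis_cV r) Xx.
by rewrite -colE !mxE.
Qed.

Lemma hdot_features x y r : X x -> X y ->
  hdot H (feature x r) (feature y r) = K y x r r.
Proof.
move=> Xx Xy.
by rewrite hdot_feature//; [rewrite featureE// mxE|exact: hset_feature].
Qed.

Lemma near_in x : X x -> \forall z \near x, X z.
Proof. by move=> Xx; exact: open_nbhs_nbhs. Qed.

(** The inner products of features are values of the continuous [K], so the features converge weakly
    as their base point tends to [x], and [f z r 0] is the inner product of [f] with a feature. *)
Lemma continuous_feature f x r : hset H f -> X x ->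
  {for x, continuous (fun z => f z r 0)}.
Proof.
move=> Hf Xx.
have [|| g Hg fg] := @hdot_cvg_weak_cvg _ _ _ H _ (nbhs x) _ (feature^~ r)
    (K x x r r).
- by apply: filterS (near_in Xx) => z; exact: hset_feature.
- have [cK _ _ _] := K11.
  have {}cK : (fun z : 'cV[R]_d * 'cV[R]_d => K z.1 z.2 r r) @ (x, x) --> K x x r r.
    apply: (@continuous_comp _ _ _ (fun z : 'cV[R]_d * 'cV[R]_d => K z.1 z.2)
      (fun M : 'M[R]_d => M r r) (x, x)).
      by apply: cK; rewrite inE.
    exact: coord_continuous.
  apply: cvg_trans cK; apply: near_eq_cvg.
  have := near_open_pair oX oX Xx Xx.
  apply: filterS => -[a b] [/= Xa Xb].
  by rewrite hdotC ?hdot_features//; exact: hset_feature.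
have {}fg : f z r 0 @[z --> x] --> hdot H g f.
  apply: cvg_trans (fg _ Hf); apply: (@near_eq_cvg _ _ (nbhs x)).
  apply: filterS (near_in Xx) => z Xz.
  by rewrite hdotC ?hdot_feature//; exact: hset_feature.
(* The limit is the value at [x], because the constant sequence [x] also tends to [x]. *)
suff E : f x r 0 = hdot H g f by move: fg; rewrite -E.
have fx : f x r 0 @[_ --> \oo] --> hdot H g f.
  exact: (@cvg_comp nat _ _ (fun=> x) _ _ _ _ (cvg_cst x) fg).
by rewrite -(cvg_lim _ fx)// lim_cst.
Unshelve. all: by end_near. Qed.

Lemma is_derive_feature x (i r : 'I_d) : X x -> exists2 g, hset H g &
  forall f, hset H f ->
    is_derive x (basis_cV i) (fun z => f z r 0) (hdot H g f).
Proof.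
move=> Xx; set e := basis_cV i.
have [cK c1 _ c12] := K11.
pose k a b := K a b r r.
have dkE a b : X a -> X b ->
    is_derive a e (k^~ b) ('D_e (K^~ b) a r r).
  by move=> Xa Xb; apply: derive_coord; have [+ _] := c1 i; apply.
have ddkE a b : X a -> X b ->
    is_derive b e (fun b => 'D_e (k^~ b) a)
      ('D_e (fun b => 'D_e (K^~ b) a) b r r).
  move=> Xa Xb; have [/(_ _ _ Xa Xb) dK _] := c12 i i.
  apply: near_eq_is_derive (derive_coord r r dK).
  (* Entry and derivative commute at points of [X], so the two functions of [b] agree near [b]. *)
  near=> b'; have Xb' : X b' by near: b'; exact: near_in.
  by have [_ ->] := dkE _ _ Xa Xb'.
have near_shift : \forall h \near (0 : R)^', X (h *: e + x).
  have [c c0 cX] := near_line e (near_in Xx).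
  by near=> h; apply: cX; near: h; exact: dnbhs0_lt.
pose D (h : R) := h^-1 *: (feature (h *: e + x) r - feature x r).
have HDelta h : X (h *: e + x) -> hset H (feature (h *: e + x) r - feature x r).
  by move=> Xh; apply: hsetB; exact: hset_feature.
have DE f h : hset H f -> X (h *: e + x) ->
    hdot H (D h) f = h^-1 * (f (h *: e + x) r 0 - f x r 0).
  move=> Hf Xh; have Hx := hset_feature r Xx; have Hxh := hset_feature r Xh.
  rewrite hdotZl//; last exact: HDelta.
  by rewrite hdotBl// !(hdotC _ Hf)// !hdot_feature.
have [|| g Hg Dg] := @hdot_cvg_weak_cvg _ _ _ H _ (0 : R)^' _ D
    ('D_e (fun b => 'D_e (k^~ b) x) x).
- by apply: filterS near_shift => h Xh; apply/hsetZ/HDelta.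
- have mdq : (fun h : R * R => (h.1 * h.2)^-1 *
     (k (h.1 *: e + x) (h.2 *: e + x) - k x (h.2 *: e + x)
      - k (h.1 *: e + x) x + k x x))
    @ filter_prod 0^' 0^' --> 'D_e (fun b => 'D_e (k^~ b) x) x.
    apply: mixed_difference_quotient.
    + apply: filterS (near_open_pair oX oX Xx Xx) => -[a b] [/= Xa Xb].
      by have [] := dkE _ _ Xa Xb.
    + apply: filterS (near_open_pair oX oX Xx Xx) => -[a b] [/= Xa Xb].
      by have [] := ddkE _ _ Xa Xb.
    + have [_ cd] := c12 i i.
      suff : (fun z : 'cV[R]_d * 'cV[R]_d =>
          'D_e (fun b => 'D_e (k^~ b) z.1) z.2) @ (x, x) -->
          'D_e (fun b => 'D_e (k^~ b) x) x by exact.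
      have [_ ->] := ddkE _ _ Xx Xx.
      have cdr : (fun z : 'cV[R]_d * 'cV[R]_d =>
          'D_e (fun b => 'D_e (K^~ b) z.1) z.2 r r) @ (x, x) -->
          'D_e (fun b => 'D_e (K^~ b) x) x r r.
        apply: (@continuous_comp _ _ _ (fun z : 'cV[R]_d * 'cV[R]_d =>
            'D_e (fun b => 'D_e (K^~ b) z.1) z.2)
          (fun M : 'M[R]_d => M r r) (x, x)).
          by apply: cd; rewrite inE.
        exact: coord_continuous.
      apply: cvg_trans cdr; apply: near_eq_cvg.
      apply: filterS (near_open_pair oX oX Xx Xx) => -[a b] [/= Xa Xb].
      by have [_ ->] := ddkE _ _ Xa Xb.
  apply: cvg_trans mdq; apply: near_eq_cvg.
  exists ((fun h : R => X (h *: e + x)), (fun h : R => X (h *: e + x))) => //=.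
  move=> [h l] [/= Xh Xl].
  have Hx := hset_feature r Xx.
  have Hxh := hset_feature r Xh; have Hxl := hset_feature r Xl.
  rewrite hdotZl//; [|exact: HDelta|exact/hsetZ/HDelta].
  rewrite hdotZr//; [|exact: HDelta|exact: HDelta].
  rewrite hdotBl//; last exact: HDelta.
  (* Symmetry of the inner product puts the [h]-shift into the first argument of [k] and the
     [l]-shift into the second. *)
  rewrite !hdotBr// !(hdotC _ Hxl)// (hdotC Hxh Hx) !hdot_features//.
  by rewrite invfM /k; ring.
exists g => // f Hf; have {}Dg := Dg _ Hf.
have cdf : h^-1 *: (f (h *: e + x) r 0 - f x r 0) @[h --> (0 : R)^'] -->
    hdot H g f.
  apply: cvg_trans Dg; apply: near_eq_cvg.
  by apply: filterS near_shift => h Xh; rewrite DE.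
split; last exact/cvg_lim.
by apply/cvg_ex; exists (hdot H g f).
Unshelve. all: by end_near. Qed.

End features.

(** * Locality and product rule for the Stein operator *)

Section stein_operator.
Context {R : realType} {d : nat} (p : 'cV[R]_d -> R) (m : 'cV[R]_d -> 'M[R]_d).
Implicit Types (f g : 'cV[R]_d -> 'cV[R]_d) (x : 'cV[R]_d).

Lemma near_eq_stein_vec f g x : (\forall z \near x, f z = g z) ->
  stein_vec p m f x = stein_vec p m g x.
Proof.
move=> fg; congr (_ * _); apply: eq_bigr => i _; apply: near_eq_derive.
by apply: filterS fg => z ->.
Qed.

Lemma stein_mxE (A : 'cV[R]_d -> 'M[R]_d) x i :
  stein_mx p m A x i 0 = stein_vec p m (fun z => col i (A z)) x.
Proof.
rewrite /stein_mx /div_mx !mxE; congr (_ * _); apply: eq_bigr => j _.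
congr ('D_ _ _ x); apply/funext => z; rewrite !mxE; congr (_ * _).
by apply: eq_bigr => r _; rewrite !mxE.
Qed.

(** The product [p * m] is treated as one coefficient, so that only partial derivatives of [f] are
    required. *)
Lemma is_derive_stein f x j : differentiable p x -> differentiable m x ->
  (forall r, derivable (fun z => f z r 0) x (basis_cV j)) ->
  is_derive x (basis_cV j) (fun z => (p z *: (m z *m f z)) j 0)
    (\sum_r (p x * m x j r * 'D_(basis_cV j) (fun z => f z r 0) x +
             'D_(basis_cV j) (fun z => p z * m z j r) x * f x r 0)).
Proof.
move=> dp dm df.
have -> : (fun z => (p z *: (m z *m f z)) j 0) =
    \sum_r (fun z => (p z * m z j r) * f z r 0).
  apply/funext => z; rewrite fct_sumE !mxE mulr_sumr.
  by apply: eq_bigr => r _; rewrite mulrA.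
apply: is_derive_sum => r.
have da : derivable (fun z => p z * m z j r) x (basis_cV j).
  apply: derivableM; first exact: diff_derivable.
  by have [] := derive_coord j r (diff_derivable (v := basis_cV j) dm).
apply: is_derive_eq (is_deriveM (derivableP da) (derivableP (df r))) _.
by rewrite /GRing.scale/= [f x r 0 * _]mulrC.
Qed.

End stein_operator.

(** * Representers of the Stein operator and the divergence form of the Stein kernel *)

Section stein_features.
Context {R : realType} {d : nat} (X : set 'cV[R]_d) (oX : open X).
Context (p : 'cV[R]_d -> R) (m : 'cV[R]_d -> 'M[R]_d).
Context (p_neq0 : forall x, X x -> p x != 0).
Context (dp : forall x, X x -> differentiable p x).
Context (dm : forall x, X x -> differentiable m x).
Context (H : hilbert_fun X) (K : 'cV[R]_d -> 'cV[R]_d -> 'M[R]_d).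
Context (K11 : kernel_C11 X K) (KH : is_kernel_of K H).
Implicit Types (f g : 'cV[R]_d -> 'cV[R]_d) (x y : 'cV[R]_d).

Local Notation S x := (restr0 X (stein1 p m K x)).

Lemma near_restr0 f y : X y -> \forall z \near y, restr0 X f z = f z.
Proof.
by move=> Xy; apply: filterS (near_in oX Xy) => z Xz; rewrite /restr0 patchT ?inE.
Qed.

Lemma has_div_hset f x : hset H f -> X x ->
  has_div (fun z => p z *: (m z *m f z)) x.
Proof.
move=> Hf Xx i.
have [] // := @is_derive_stein _ _ p m f x i (dp Xx) (dm Xx).
by move=> r; have [g _ /(_ _ Hf)[]] := is_derive_feature oX K11 KH i r Xx.
Qed.

Lemma stein_vec_hset x : X x -> exists2 s, hset H s &
  forall f, hset H f -> stein_vec p m f x = hdot H s f.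
Proof.
move=> Xx.
have /choice[g gP] (ir : 'I_d * 'I_d) : exists g, hset H g /\
    forall f, hset H f ->
    is_derive x (basis_cV ir.1) (fun z => f z ir.2 0) (hdot H g f).
  by have [g] := is_derive_feature oX K11 KH ir.1 ir.2 Xx; exists g.
have Hg i r : hset H (g (i, r)) by case: (gP (i, r)).
have dg i r f : hset H f ->
    is_derive x (basis_cV i) (fun z => f z r 0) (hdot H (g (i, r)) f).
  by case: (gP (i, r)) => _; exact.
pose a i r := p x * m x i r.
pose da i r := 'D_(basis_cV i) (fun z => p z * m z i r) x.
have Hag i r : hset H (a i r *: g (i, r)) by exact: hsetZ.
have Haf i r : hset H (da i r *: feature X K x r).
  by apply/hsetZ/hset_feature.
(* The product rule with each derivative of [f] replaced by its representer [g (i, r)] and each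
   value of [f] by a feature. *)
pose s := (p x)^-1 *: \sum_i \sum_r
  (a i r *: g (i, r) + da i r *: feature X K x r).
have Hr i : hset H (\sum_r (a i r *: g (i, r) + da i r *: feature X K x r)).
  by apply: hset_sum => r; exact: hsetD.
exists s; first by apply/hsetZ/hset_sum.
move=> f Hf; rewrite hdotZl//; last exact: hset_sum.
congr (_ * _); rewrite hdot_suml//; apply: eq_bigr => i _.
rewrite hdot_suml//; last by move=> r; exact: hsetD.
have df r : derivable (fun z => f z r 0) x (basis_cV i).
  by have [] := dg i r _ Hf.
have [_ ->] := is_derive_stein (dp Xx) (dm Xx) df.
apply: eq_bigr => r _; have Hx := hset_feature KH r Xx.
rewrite hdotDl// !hdotZl//; have [_ ->] := dg i r _ Hf.
by rewrite (hdotC Hx Hf) (hdot_feature KH).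
Qed.

Lemma stein1E x y i : X x -> X y ->
  stein1 p m K x y i 0 = stein_vec p m (feature X K y i) x.
Proof.
move=> Xx Xy; rewrite /stein1 stein_mxE; apply: near_eq_stein_vec.
by apply: filterS (near_in oX Xx) => z Xz; rewrite featureE.
Qed.

Lemma stein_vec_reproducing x : X x ->
  hset H (S x) /\ forall f, hset H f -> stein_vec p m f x = hdot H (S x) f.
Proof.
move=> Xx; have [s Hs sP] := stein_vec_hset Xx.
suff -> : S x = s by [].
(* Off [X] both sides are 0. On [X], component [i] of [s] at [y] is its inner product with a
   feature, which is the Stein operator applied to that feature. *)
apply/funext => y; have [Xy|nXy] := pselect (X y); last first.
  by rewrite (hset_supp Hs)// /restr0 patchC// inE.
rewrite /restr0 patchT ?inE//; apply/matrixP => i j; rewrite ord1 stein1E//.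
by rewrite sP ?(hdot_feature KH)//; exact: hset_feature.
Qed.

Lemma stein_kernelE x y : X x -> X y ->
  stein_kernel p m K x y = stein_vec p m (S x) y.
Proof.
move=> Xx Xy; apply: near_eq_stein_vec.
by apply: filterS (near_restr0 (stein1 p m K x) Xy) => z ->.
Qed.

Lemma stein_kernel_div x y : X x -> X y ->
  stein_kernel p m K x y = (p y * p x)^-1 * div_vec (fun y' =>
    div_mx (fun x' => (p x' * p y') *: (m x' *m K x' y' *m (m y')^T)) x) y.
Proof.
move=> Xx Xy; rewrite invfM -mulrA; congr (_ * _); rewrite mulr_sumr.
apply: eq_bigr => l _.
pose F z := (p z *: (m z *m stein1 p m K x z)) l 0.
have dF : derivable F y (basis_cV l).
  have [HS _] := stein_vec_reproducing Xx.
  have dS : derivable (fun z => (p z *: (m z *m S x z)) l 0) y (basis_cV l).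
    exact: has_div_hset HS Xy l.
  apply: (near_eq_derivable _ dS).
  by apply: filterS (near_restr0 (stein1 p m K x) Xy) => z ->.
(* The factor [1 / p(x)] inside [stein1] is pulled out of the derivative in [y], which [dF]
   permits. *)
transitivity ((p x)^-1 * 'D_(basis_cV l) (p x *: F) y); last first.
  congr (_ * _); apply: near_eq_derive.
  apply: filterS (near_in oX Xy) => z Xz.
  pose G s := stein_vec p m (feature X K z s) x.
  have -> : (p x *: F) z = p z * \sum_s m z l s * (p x * G s).
    transitivity (p x * F z) => //; rewrite /F !mxE mulrCA; congr (_ * _).
    rewrite mulr_sumr; apply: eq_bigr => s _.
    by rewrite stein1E// mulrCA.
  rewrite !mxE.
  pose q j s x' := (p x' *: (m x' *m feature X K z s x')) j 0.
  have dq j s : derivable (q j s) x (basis_cV j).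
    by apply: has_div_hset => //; exact: hset_feature.
  (* The coefficients [p z * m z l s] do not depend on the variable [x'], so they move through the
     derivative in [x]. *)
  transitivity (\sum_j 'D_(basis_cV j) (\sum_s (p z * m z l s) *: q j s) x).
    under [RHS]eq_bigr => j _.
      rewrite derive_sum; last by move=> s; exact: derivableZ.
      under eq_bigr => s _ do rewrite deriveZ//=.
      over.
    rewrite exchange_big mulr_sumr; apply: eq_bigr => s _.
    rewrite /G /stein_vec mulVKf ?p_neq0// -scaler_sumr.
    by rewrite mulrA.
  apply: eq_bigr => j _; apply: near_eq_derive.
  apply: filterS (near_in oX Xx) => x' Xx'.
  rewrite fct_sumE !mxE mulr_sumr; apply: eq_bigr => s _.
  rewrite /q /GRing.scale/= featureE// !mxE.
  have -> : \sum_t m x' j t * col s (K x' z) t 0 = \sum_t m x' j t * K x' z t s.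
    by apply: eq_bigr => t _; rewrite mxE.
  set c := \sum_t _; rewrite -[LHS]/(p z * m z l s * (p x' * c)).
  by ring.
by rewrite deriveZ// /GRing.scale/= mulKf// p_neq0.
Qed.

End stein_features.

(** * Borel measurability of continuous functions and of directional derivatives *)

Section borel_measurability.
Context {R : realType} {d : nat}.
Implicit Types (X : set 'cV[R]_d) (u : 'cV[R]_d -> R).

Lemma open_measurable_borel X : open X -> measurable (X : set (borel R d)).
Proof. by move=> oX; exact: sub_sigma_algebra. Qed.

Lemma measurable_shift (v : 'cV[R]_d) :
  measurable_fun [set: borel R d] (fun x : borel R d => (v + x : borel R d)).
Proof.
apply: (@measurability _ _ (borel R d) (borel R d) setT _ (@open 'cV[R]_d)) => // _ [A oA <-].
rewrite setTI; apply: open_measurable_borel.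
have shift_cont : continuous (fun x : 'cV[R]_d => v + x).
  by move=> x; exact: (cvgD (@cvg_cst _ v _ (nbhs x) _) cvg_id).
by move/continuousP : shift_cont; exact.
Qed.

Lemma continuous_measurable_borel X u : open X ->
  (forall x, X x -> {for x, continuous u}) ->
  measurable_fun (X : set (borel R d)) u.
Proof.
move=> oX cu; apply: (measurability _ (RGenOpens.measurableE R)).
move=> _ [_ [a [b ->] <-]]; apply: open_measurable_borel.
rewrite openE => x [Xx ux]; apply: filterI; first exact: open_nbhs_nbhs.
by apply: cu => //; apply: open_nbhs_nbhs; split => //; exact: interval_open.
Qed.

(** The derivative is the pointwise limit on [X] of the measurable difference quotients with step
    [1 / (n + 1)]. *)
Lemma measurable_derive X u (v : 'cV[R]_d) : open X ->
  (forall x, X x -> {for x, continuous u}) ->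
  (forall x, X x -> derivable u x v) ->
  measurable_fun (X : set (borel R d)) ('D_v u).
Proof.
move=> oX cu du; have mX := open_measurable_borel oX.
have mu := continuous_measurable_borel oX cu.
(* u is only measurable on X, and x + v / n may lie outside of X *)
pose U : borel R d -> R := u \_ (X : set (borel R d)).
have mU : measurable_fun [set: borel R d] U.
  exact: (measurable_restrictT (u : borel R d -> R) mX).1.
pose h (n : nat) (x : borel R d) : R :=
  n.+1%:R * (U (n.+1%:R^-1 *: v + x) - U x).
apply: (@measurable_fun_cvg _ _ _ _ h) => [n|x Xx].
  apply: measurable_funTS; apply: measurable_funM; first exact: measurable_cst.
  apply: measurable_funB => //.
  exact: (measurableT_comp mU (measurable_shift _)).
have inv0 : n.+1%:R^-1 @[n --> \oo] --> (0 : R)^'.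
  move=> A /= A0; have : \forall n \near \oo, (n.+1%:R^-1 : R) != 0 ->
      A n.+1%:R^-1 by exact: (@cvg_harmonic R _ A0).
  by apply: filterS => n; apply; rewrite invr_neq0.
apply: cvg_trans (cvg_comp _ _ inv0 (du x Xx)); apply: near_eq_cvg.
have [c c0 cX] := near_line v (near_in oX Xx).
have : \forall n \near \oo, n.+1%:R^-1 < c.
  exact: near_infty_natSinv_lt (PosNum c0).
apply: filterS => n nc; rewrite /h /= invrK /U !patchT ?inE//.
by apply: cX; rewrite ger0_norm.
Qed.

End borel_measurability.

(** * Integration against [Q] and the closed form of the discrepancy *)

Section ksd.
Context {R : realType} {d : nat} (X : set 'cV[R]_d) (oX : open X).
Context (Q : probability (borel R d) R).
Context (p : 'cV[R]_d -> R) (m : 'cV[R]_d -> 'M[R]_d).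
Context (p_neq0 : forall x, X x -> p x != 0).
Context (dp : forall x, X x -> differentiable p x).
Context (dm : forall x, X x -> differentiable m x).
Context (H : hilbert_fun X) (K : 'cV[R]_d -> 'cV[R]_d -> 'M[R]_d).
Context (K11 : kernel_C11 X K) (KH : is_kernel_of K H).
Implicit Types (f g : 'cV[R]_d -> 'cV[R]_d) (x y : 'cV[R]_d).

Local Notation S x := (restr0 X (stein1 p m K x)).
Local Notation stein := (stein_vec p m).
Context (intS : Q.-integrable X (fun x => (hnorm H (S x))%:E)).

Let mX : measurable (X : set (borel R d)) := open_measurable_borel oX.

Lemma measurable_stein_vec f : hset H f ->
  measurable_fun (X : set (borel R d)) (stein f).
Proof.
move=> Hf; apply: measurable_funM.
  apply: continuous_measurable_borel => // x Xx.
  exact: (@cvgV _ _ (nbhs x) _ p (p x) (p_neq0 Xx)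
    (differentiable_continuous (dp Xx))).
apply: measurable_sum => i; apply: measurable_derive => // x Xx; last first.
  exact: (has_div_hset oX dp dm K11 KH Hf Xx).
have cf r : {for x, continuous (fun z => f z r 0)}.
  exact: (continuous_feature oX K11 KH).
have -> : (fun z => (p z *: (m z *m f z)) i 0) =
    (fun z => p z * \sum_r m z i r * f z r 0).
  by apply/funext => z; rewrite !mxE.
apply: (@cvgM _ _ (nbhs x)); first exact: differentiable_continuous (dp Xx).
apply: (@cvg_big R _ +%R 0 xpredT (@add_continuous _) _ (nbhs x)) => r _.
apply: (@cvgM _ _ (nbhs x)); last exact: cf.
apply: (@continuous_comp _ _ _ m (fun M : 'M[R]_d => M i r)).
  exact: differentiable_continuous (dm Xx).
exact: coord_continuous.
Qed.

Lemma stein_vec_le f x : hset H f -> X x ->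
  `|stein f x| <= hnorm H f * hnorm H (S x).
Proof.
move=> Hf Xx; have [HS SP] := stein_vec_reproducing oX dp dm K11 KH Xx.
by rewrite SP// mulrC cauchy_schwarz.
Qed.

Lemma integrable_stein_vec f : hset H f -> Q.-integrable X (EFin \o stein f).
Proof.
move=> Hf.
apply: (le_integrable mX _ _ (integrableZl mX (hnorm H f) intS)).
  by apply/measurable_EFinP; exact: measurable_stein_vec.
move=> x Xx /=; rewrite lee_fin [leRHS]ger0_norm ?stein_vec_le//.
by rewrite mulr_ge0 ?sqrtr_ge0.
Qed.

Lemma stein_vecZD (a : R) f g x : hset H f -> hset H g -> X x ->
  stein (a *: f + g) x = a * stein f x + stein g x.
Proof.
move=> Hf Hg Xx; have [HS SP] := stein_vec_reproducing oX dp dm K11 KH Xx.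
have Haf := hsetZ a Hf.
by rewrite !SP ?hdotDr ?hdotZr//; exact: hsetZD.
Qed.

(** [M] is the weak [Q]-mean of the representers [S x]. Riesz applies because the functional is
    bounded by the integral of their norms. *)
Lemma mean_embedding : exists2 M, hset H M &
  forall f, hset H f -> (\int[Q]_(x in X) (stein f x)%:E)%E = (hdot H M f)%:E.
Proof.
pose L f := \int[Q]_(x in X) stein f x.
have [a f g Hf Hg|f Hf|M HM ML] :=
    @riesz _ _ _ H L (\int[Q]_(x in X) hnorm H (S x)).
- rewrite /L -RintegralZl//; last exact: integrable_stein_vec.
  rewrite -RintegralD//; last exact: integrable_stein_vec.
    by apply: eq_Rintegral => x /[!inE] Xx; rewrite stein_vecZD.
  exact: (integrableZl mX a (integrable_stein_vec Hf)).
- apply: le_trans (le_normr_Rintegral mX (integrable_stein_vec Hf)) _.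
  rewrite mulrC -RintegralZl//; apply: le_Rintegral => //.
  + exact/integrable_norm/integrable_stein_vec.
  + exact: (integrableZl mX (hnorm H f) intS).
  + by move=> x Xx; exact: stein_vec_le.
exists M => // f Hf; rewrite -ML// fineK//.
exact/integrable_fin_num/integrable_stein_vec.
Qed.

Lemma DKSD_sq_stein_kernel : DKSD_sq H p m Q =
  (\int[Q]_(y in X) \int[Q]_(x in X) (stein_kernel p m K x y)%:E)%E.
Proof.
have [M HM ML] := mean_embedding.
transitivity ((hdot H M M)%:E).
- have M0 := hdot_ge0 HM.
  apply/eqP; rewrite eq_le; apply/andP; split.
    apply: ge_ereal_sup => _ [h [Hh h1] <-].
    rewrite ML// abse_EFin -EFin_expe lee_fin real_normK ?num_real//.
    apply: le_trans (cauchy_schwarz_sq HM Hh) _.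
    by rewrite ler_piMr// -sqr_hnorm// exprn_ile1 ?sqrtr_ge0.
  (* The supremum is attained at [M] divided by its norm, or at 0 if that norm vanishes. *)
  apply: ereal_sup_ubound; set a := (hnorm H M)^-1.
  have Ha := hsetZ a HM.
  have [M00|M00] := eqVneq (hnorm H M) 0.
    exists 0; first split; first exact: hset_0.
      by rewrite /hnorm hdot0l ?sqrtr0//; exact: hset_0.
    rewrite ML; last exact: hset_0.
    rewrite hdotC ?hdot0l//; [|exact: hset_0..].
    by rewrite -sqr_hnorm// M00 abse_EFin -EFin_expe normr0.
  exists (a *: M); first split => //.
    rewrite /hnorm hdotZl// hdotZr// -sqr_hnorm// mulrA -expr2 -exprMn.
    by rewrite mulVf// expr1n sqrtr1.
  rewrite ML// abse_EFin -EFin_expe real_normK ?num_real// hdotZr//.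
  by congr (_%:E); rewrite -sqr_hnorm// /a; field.
(* The property of [M] is used twice: with [f = M] for the outer integral, then with [f = S y] for
   the inner one. The integrand becomes the inner product of [S x] and [S y], which is the kernel,
   and no exchange of integrals occurs. *)
- rewrite -ML//; apply: eq_integral => y /[!inE] Xy.
  have [HSy SyP] := stein_vec_reproducing oX dp dm K11 KH Xy.
  rewrite SyP// hdotC//; apply: etrans (esym (ML _ HSy)) _.
  apply: eq_integral => x /[!inE] Xx.
  have [HSx SxP] := stein_vec_reproducing oX dp dm K11 KH Xx.
  congr (_%:E); rewrite (stein_kernelE oX p m K Xx Xy).
  by rewrite SyP// SxP// hdotC.
Qed.

End ksd.

Theorem theorem1 (R : realType) (d : nat) (X : set 'cV[R]_d) (oX : open X)
    (P Q : probability (borel R d) R)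
    (PX : P X = 1%E) (QX : Q X = 1%E)
    (p : 'cV[R]_d -> R) (Pp : has_positive_density X P p)
    (m : 'cV[R]_d -> 'M[R]_d)
    (dp : forall x, X x -> differentiable p x)
    (dm : forall x, X x -> differentiable m x)
    (K : 'cV[R]_d -> 'cV[R]_d -> 'M[R]_d) (K11 : kernel_C11 X K)
    (H : hilbert_fun X) (KH : is_kernel_of K H) :
  [/\ (forall x, X x ->
         hset H (restr0 X (stein1 p m K x)) /\
         forall f, hset H f ->
           has_div (fun z => p z *: (m z *m f z)) x /\
           stein_vec p m f x = hdot H (restr0 X (stein1 p m K x)) f),
      (forall x y, X x -> X y ->
         stein_kernel p m K x y =
         (p y * p x)^-1 *
         div_vec (fun y' =>
           div_mx (fun x' => (p x' * p y') *: (m x' *m K x' y' *m (m y')^T)) x)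
           y) &
      (Q.-integrable X (fun x => (hnorm H (restr0 X (stein1 p m K x)))%:E) ->
       DKSD_sq H p m Q =
       (\int[Q]_(y in X) \int[Q]_(x in X) (stein_kernel p m K x y)%:E)%E)].
Proof.
have p_neq0 x : X x -> p x != 0 by case: Pp => p0 _ /p0; exact: lt0r_neq0.
split.
- move=> x Xx; have [HS SP] := stein_vec_reproducing oX dp dm K11 KH Xx.
  split=> // f Hf; split; last exact: SP.
  exact: (has_div_hset oX dp dm K11 KH Hf Xx).
- by move=> x y Xx Xy; exact: (stein_kernel_div oX p_neq0 dp dm K11 KH).
- by move=> intS; exact: (DKSD_sq_stein_kernel oX p_neq0 dp dm K11 KH).
Qed.
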